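(* Let $G$ be a finite nilpotent group of nilpotency class $2$, let $k\ge1$ and $w\in F_k$. Then for every $g$ in the image $w(G)$ we have $$P_{w,G}(g)\ \ge\ \frac{1}{|G'|\,|G|},$$ where $G'=[G,G]$ is the derived subgroup of $G$.
   Context: $F_k$ is the free group on $x_1,\dots,x_k$; $w\in F_k$ induces a word map $w:G^k\to G$ by evaluation, with image $w(G)$. For $g\in G$, $P_{w,G}(g):=|\{(g_1,\dots,g_k)\in G^k: w(g_1,\dots,g_k)=g\}|/|G|^k$. *)

(* Defs.v *)
From mathcomp Require Import all_boot all_order all_algebra all_fingroup all_solvable.
Set Implicit Arguments. Unset Strict Implicit. Unset Printing Implicit Defensive.

(* Elements of the free group F_k on x_1..x_k are represented by (not
   necessarily reduced) words: a letter (i, b) stands for x_i if b = false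
   and x_i^-1 if b = true. Every element of F_k is represented by some word,
   and the evaluation map below factors through free reduction. *)
Definition fword (k : nat) := seq ('I_k * bool).

Definition eval_word (gT : finGroupType) (k : nat) (w : fword k)
    (t : {ffun 'I_k -> gT}) : gT :=
  foldr (fun l acc => ((if l.2 then (t l.1)^-1 else t l.1) * acc)%g) 1%g w.

Definition tuples_in (gT : finGroupType) (k : nat) (G : {group gT}) :=
  [set t : {ffun 'I_k -> gT} | [forall i, t i \in G]].

Definition word_image (gT : finGroupType) (k : nat) (w : fword k) (G : {group gT}) :=
  [set eval_word w t | t in tuples_in k G].

Definition word_prob (gT : finGroupType) (k : nat) (w : fword k) (G : {group gT})
    (g : gT) : rat :=
  ((#|[set t in tuples_in k G | eval_word w t == g]|)%:R
     / ((#|G| ^ k)%N)%:R)%R.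

(* Main.v *)
(* In a group of class 2 every word equals, up to an integral change of
   variables, x_1^d times a product of powers of commutators [x_i, x_j]; the
   change of variables can be chosen to make the exponent matrix of the
   commutators tridiagonal, so that only indices of opposite parity are paired.
   Fix a solution of w(x) = g.  With the odd variables x_1, x_3, ... frozen, the
   even ones enter through a homomorphism to G', so every choice of odd
   variables admitting a solution admits at least |G|^e / |G'| of them, e being
   the number of even variables.  With the even variables frozen instead, let x_1
   vary in its coset of the central subgroup G' and x_3, x_5, ... in G: this is
   again a homomorphism to G', so at least |G|^(k - e - 1) choices of the odd
   variables admit a solution.  In the code indices start at 0, which exchanges
   the words odd and even. *)

From HB Require Import structures.
Require Import Defs.
From mathcomp Require Import all_boot all_order all_algebra all_fingroup all_solvable.
Import GRing.Theory Num.Theory.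
Set Implicit Arguments. Unset Strict Implicit. Unset Printing Implicit Defensive.

(** * Integer row reduction and congruence of skew matrices *)

Lemma row_reduction_int n (v : 'rV[int]_n) :
  exists2 U : 'M[int]_n, U \in unitmx &
    forall j : 'I_n, (0 < j)%N -> ((v *m U) 0 j = 0)%R.
Proof.
have [L _ [R Ru [d _ ->]]] := int_Smith_normal_form v.
exists (invmx R); first by rewrite unitmx_inv.
move=> j j_gt0; rewrite mulmxK // mxE big_ord1 !mxE /=.
by rewrite eq_sym gtn_eqF // mulr0n mulr0.
Qed.

Section Tridiagonal.
Local Open Scope ring_scope.

(** The part [r] of the first row of [A] is the vector fed to the hypothesis: [U] leaves only its
    entry 0, which is entry (0, 1) of the whole matrix and pairs opposite parities. In the lower
    block both indices shift by one, so equality of parities persists. Fixing the first coordinate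
    later protects the power of x_0. *)
Lemma bipartite_congruence_step n (A : 'M[int]_(1 + n)) :
    (forall (v : 'rV[int]_n) (B : 'M[int]_n), B^T = - B -> exists2 U, U \in unitmx &
       (forall j : 'I_n, (0 < j)%N -> (v *m U) 0 j = 0) /\
       (forall i j : 'I_n, odd i = odd j -> (U^T *m B *m U) i j = 0)) ->
    A^T = - A ->
  exists2 U : 'M[int]_n, U \in unitmx &
    forall i j : 'I_(1 + n), odd i = odd j ->
      ((block_mx (1%:M : 'M_1) 0 0 U)^T *m A *m block_mx (1%:M : 'M_1) 0 0 U) i j = 0.
Proof.
move=> IH; rewrite -[A]submxK; move: (ulsubmx A) (ursubmx A) => a r.
move: (dlsubmx A) (drsubmx A) => s B.
rewrite tr_block_mx opp_block_mx => /eq_block_mx[aN _ sN BN].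
have [U Uu [rU UBU]] := IH r B BN; exists U => // i j.
rewrite tr_block_mx !trmx0 trmx1 !mulmx_block !(mul1mx, mul0mx, mulmx1, mulmx0).
rewrite !(addr0, add0r).
have a0: a = 0.
  apply/matrixP=> x y; have /matrixP/(_ x x) := aN; rewrite !mxE !ord1 => /eqP.
  by rewrite -addr_eq0 -mulr2n mulrn_eq0 /= => /eqP.
have -> : s = - r^T by rewrite sN opprK.
case: (split_ordP i) => {}i ->; case: (split_ordP j) => {}j ->;
  rewrite ?(block_mxEul, block_mxEur, block_mxEdl, block_mxEdr) /= ?a0 ?ord1.
- by rewrite mxE.
- move=> oj; by rewrite rU //; case: (j : nat) oj.
- move=> oi; rewrite mulmxN -trmx_mul mxE [_^T _ _]mxE rU ?oppr0 //.
  by case: (i : nat) oi.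
- by move=> /negb_inj; apply: UBU.
Qed.

(** The vector [v] strengthens the induction: it stands for the first row of the next larger matrix.
    Once concentrated at index 0 it stays so, because the step fixes that coordinate. *)
Lemma bipartite_congruence n (v : 'rV[int]_n) (A : 'M[int]_n) : A^T = - A ->
  exists2 U : 'M[int]_n, U \in unitmx &
    (forall j : 'I_n, (0 < j)%N -> (v *m U) 0 j = 0) /\
    (forall i j : 'I_n, odd i = odd j -> (U^T *m A *m U) i j = 0).
Proof.
elim: n => [|n IHn] in v A * => AN.
  by exists 1%:M; [apply: unitmx1 | split=> [[]|[]]].
have [R Ru vR] := row_reduction_int v.
have RAN : (R^T *m A *m R)^T = - (R^T *m A *m R).
  by rewrite !trmx_mul trmxK AN mulNmx mulmxN mulmxA.
have [U Uu UP] := @bipartite_congruence_step n (R^T *m A *m R) IHn RAN.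
exists (R *m (block_mx (1%:M : 'M_1) 0 0 U : 'M_(1 + n))).
  by rewrite unitmx_mul Ru /= unitmxE (det_ublock (1%:M : 'M_1)) det1 mul1r.
split=> [j j_gt0|i j oij]; last first.
  by rewrite -[RHS](UP i j) // trmx_mul !mulmxA.
rewrite mulmxA; set u := v *m R; rewrite -[u](@hsubmxK _ 1 1 n).
have -> : @rsubmx _ 1 1 n u = 0.
  by apply/matrixP=> x y; rewrite mxE [RHS]mxE ord1 vR.
rewrite (@mul_row_block _ 1 1 n 1 n) !(mulmx0, mul0mx) !addr0.
case: (@split_ordP 1 n j) j_gt0 => {}j -> /=; first by rewrite ord1.
by rewrite (@row_mxEr _ 1 1 n) mxE.
Qed.

End Tridiagonal.

(** For [x] in a given fibre, [tau x] injects that fibre into the one over [phi a], which is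
    therefore a largest fibre. This gives the pigeonhole bound for maps that are only affine. *)
Lemma card_fiber_ge (X Y : finType) (phi : X -> Y) (a : X) (tau : X -> X -> X) :
    (forall x, injective (tau x)) ->
    (forall x y, phi x = phi y -> phi (tau x y) = phi a) ->
  (#|X| <= #|Y| * #|[set x | phi x == phi a]|)%N.
Proof.
move=> tau_inj tauP.
rewrite -[#|X|]sum1_card (partition_big phi (fun y => y \in Y)) //= -sum_nat_const.
apply: leq_sum => b _; rewrite sum1_card.
have [x /eqP xb|b0] := pickP (fun x => phi x == b); last first.
  by rewrite (eq_card0 (A := [pred x | phi x == b])).
rewrite -(card_imset _ (tau_inj x)); apply/subset_leq_card/subsetP=> _ /imsetP[y + ->].
by rewrite !inE => /eqP yb; rewrite tauP // xb.
Qed.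

(** * Integer powers in a finite group *)

Section IntegerPowers.
Variable gT : finGroupType.
Implicit Types (x y : gT) (a b : int).
Local Open Scope group_scope.

Definition zpow x a := match a with Posz n => x ^+ n | Negz n => x ^- n.+1 end.

Lemma zpow1 x : zpow x 1 = x. Proof. exact: expg1. Qed.

Lemma zpowSr x (n : nat) : zpow x n.+1 = zpow x n * x.
Proof. exact: expgSr. Qed.

Lemma zpowNSr x (n : nat) : zpow x (- n.+1%:Z) = zpow x (- n%:Z) * x^-1.
Proof.
case: n => [|n]; first by rewrite /= expg1 mul1g.
by rewrite -!NegzE /= expgS invMg.
Qed.

Lemma zpowD1 x a : zpow x (a + 1) = zpow x a * x.
Proof.
case: a => [n|n]; first by rewrite -PoszD addn1 zpowSr.
by rewrite NegzE zpowNSr mulgKV -addn1 PoszD opprD addrK.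
Qed.

Lemma zpowB1 x a : zpow x (a - 1) = zpow x a * x^-1.
Proof. by rewrite -[in RHS](subrK 1%R a) zpowD1 mulgK. Qed.

Lemma zpowD x a b : zpow x (a + b) = zpow x a * zpow x b.
Proof.
elim: b => [|n IH|n IH]; first by rewrite addr0 mulg1.
  by rewrite -addn1 PoszD addrA !zpowD1 IH mulgA.
by rewrite -addn1 PoszD opprD addrA !zpowB1 IH mulgA.
Qed.

End IntegerPowers.

(** * Groups with central commutators

    [e] embeds an additive group [A] as a central subgroup of [gT] containing
    all commutators, and [c] is the commutator map with values in [A]. *)

Section CentralCommutators.
Variables (gT : finGroupType) (A : finZmodType).
Variables (e : A -> gT) (c : gT -> gT -> A).
Hypothesis eD : {morph e : a b / (a + b)%R >-> (a * b)%g}.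
Hypothesis e_inj : injective e.
Hypothesis eZ : forall a x, commute (e a) x.
Hypothesis eC : forall x y, e (c x y) = [~ x, y]%g.
Local Open Scope group_scope.

Lemma embed0 : e 0%R = 1.
Proof. by apply: (mulgI (e 0%R)); rewrite -eD addr0 mulg1. Qed.

Lemma embedN a : e (- a)%R = (e a)^-1.
Proof. by apply: (mulgI (e a)); rewrite -eD subrr embed0 mulgV. Qed.

Lemma comm_swap x y : x * y = y * x * e (c x y).
Proof. by rewrite eC -commgC. Qed.

Lemma ccommMl x y z : (c (x * y)%g z = c x z + c y z)%R.
Proof.
apply: e_inj; rewrite eD !eC commMgJ; congr (_ * _).
by rewrite -eC conjgE eZ mulKg.
Qed.

Lemma ccommC x y : (c y x = - c x y)%R.
Proof. by apply: e_inj; rewrite embedN !eC invg_comm. Qed.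

Lemma ccommMr x y z : (c x (y * z)%g = c x y + c x z)%R.
Proof. by rewrite ccommC ccommMl opprD -!ccommC. Qed.

Lemma ccommxx x : c x x = 0%R.
Proof. by apply: e_inj; rewrite eC commgg embed0. Qed.

Lemma ccomm1l y : c 1 y = 0%R.
Proof. by apply: e_inj; rewrite eC comm1g embed0. Qed.

Lemma ccommVl x y : (c x^-1%g y = - c x y)%R.
Proof. by apply/eqP; rewrite -addr_eq0 -ccommMl mulVg ccomm1l. Qed.

Lemma ccommVr x y : (c x y^-1%g = - c x y)%R.
Proof. by rewrite ccommC ccommVl -ccommC. Qed.

Lemma ccomm_embedl a y : c (e a) y = 0%R.
Proof. by apply: e_inj; rewrite eC embed0; apply/eqP/commgP/eZ. Qed.

Lemma ccommM_embedl x a y : c (x * e a)%g y = c x y.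
Proof. by rewrite ccommMl ccomm_embedl addr0. Qed.

Lemma ccommM_embedr x a y : c x (y * e a)%g = c x y.
Proof. by rewrite ccommC ccommM_embedl -ccommC. Qed.

Lemma ccomm_zpowl x y z : (c (zpow x z) y = c x y *~ z)%R.
Proof.
elim: z => [|n IH|n IH]; first by rewrite ccomm1l.
  by rewrite zpowSr ccommMl IH -addn1 PoszD mulrzDr.
by rewrite zpowNSr ccommMl IH ccommVl -addn1 PoszD opprD mulrzDr mulrNz.
Qed.

Lemma ccomm_zpowr x y z : (c x (zpow y z) = c x y *~ z)%R.
Proof. by rewrite ccommC ccomm_zpowl [c y x]ccommC mulNrz opprK. Qed.

Lemma zpowM_embed x a z : zpow (x * e a) z = zpow x z * e (a *~ z)%R.
Proof.
elim: z => [|n IH|n IH]; first by rewrite embed0 mulg1.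
  rewrite !zpowSr IH -addn1 PoszD mulrzDr eD -!mulgA; congr (_ * _).
  by rewrite mulr1z [LHS]eZ -mulgA -!eD addrC.
rewrite !zpowNSr IH -addn1 PoszD opprD mulrzDr mulrN1z eD embedN invMg -!mulgA.
by congr (_ * _); rewrite mulgA -embedN -eD [LHS]eZ.
Qed.

(** * Normal form of words and integral changes of variables *)

Section Tuples.
Variable n : nat.
Local Notation X := {ffun 'I_n -> gT}.
Implicit Types (t u : X) (m : 'rV[int]_n) (S U : 'M[int]_n).

(** Additive form of the product of the powers [t_i, t_j]^(S_ij), whose order is irrelevant as
    commutators are central. *)
Definition cform S t : A := (\sum_i \sum_j c (t i) (t j) *~ S i j)%R.

Definition mono m t : gT := \prod_(i < n) zpow (t i) (m 0%R i).

Definition subst_mx U t : X := [ffun i => mono (row i U) t].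

Lemma cformD S S' t : (cform (S + S') t = cform S t + cform S' t)%R.
Proof.
rewrite -big_split; apply: eq_bigr => i _; rewrite -big_split.
by apply: eq_bigr => j _; rewrite mxE mulrzDr.
Qed.

Lemma cform0 t : cform 0 t = 0%R.
Proof. by apply: big1 => i _; apply: big1 => j _; rewrite mxE. Qed.

Lemma cformN S t : (cform (- S) t = - cform S t)%R.
Proof. by apply/eqP; rewrite -addr_eq0 -cformD addNr cform0. Qed.

Lemma cform_central S t (a : 'I_n -> A) :
  cform S [ffun i => t i * e (a i)] = cform S t.
Proof.
by apply: eq_bigr => i _; apply: eq_bigr => j _; rewrite !ffunE ccommM_embedl ccommM_embedr.
Qed.

Lemma ccomm_prodl (r : seq 'I_n) m t y :
  (c (\prod_(i <- r) zpow (t i) (m 0%R i))%g y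
    = \sum_(i <- r) c (t i) y *~ m 0 i)%R.
Proof.
rewrite (big_morph (c^~ y) (fun x x' => ccommMl x x' y) (ccomm1l y)).
by apply: eq_bigr => i _; rewrite ccomm_zpowl.
Qed.

Lemma ccomm_mono m m' t :
  (c (mono m t) (mono m' t) = cform (m^T *m m') t)%R.
Proof.
rewrite ccomm_prodl; apply: eq_bigr => i _.
rewrite ccommC ccomm_prodl -sumrN mulrz_suml; apply: eq_bigr => j _.
by rewrite -mulNrz -ccommC -mulrzA mxE big_ord1 mxE mulrC.
Qed.

Lemma cform_subst S U t :
  cform S (subst_mx U t) = cform (U^T *m S *m U) t.
Proof.
(* By bilinearity the commutator of two monomials has a rank one exponent matrix; these add up to
   the congruent matrix. *)
pose F i j := (cform (S i j *: ((row i U)^T *m row j U)) t)%R.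
transitivity (\sum_i \sum_j F i j)%R.
  apply: eq_bigr => i _; apply: eq_bigr => j _; rewrite !ffunE ccomm_mono /F.
  rewrite /cform mulrz_suml; apply: eq_bigr => k _; rewrite mulrz_suml.
  by apply: eq_bigr => l _; rewrite [in RHS]mxE mulrC mulrzA.
transitivity (cform (\sum_i \sum_j S i j *: ((row i U)^T *m row j U))%R t).
  rewrite (big_morph (cform^~ t) (fun S S' => cformD S S' t) (cform0 t)).
  apply: eq_bigr => i _.
  by rewrite (big_morph (cform^~ t) (fun S S' => cformD S S' t) (cform0 t)).
congr (cform _ t); apply/matrixP=> k l; rewrite summxE mxE.
rewrite (eq_bigr (fun i => \sum_j U i k * S i j * U j l)%R) => [|i _].
  rewrite exchange_big; apply: eq_bigr => j _; rewrite !mxE big_distrl.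
  by apply: eq_bigr => i _; rewrite !mxE.
rewrite summxE; apply: eq_bigr => j _; rewrite !mxE big_ord1 !mxE.
by rewrite mulrCA mulrA.
Qed.

(* Commutators being alternating, only [W - W^T] matters. *)
Lemma cform_upper W t :
  cform W t = cform (\matrix_(i, j) if (i < j)%N then W i j - W j i else 0)%R t.
Proof.
pose F (i j : 'I_n) := (c (t i) (t j) *~ W i j)%R.
pose G (i j : 'I_n) := (if (i < j)%N then F i j else 0)%R.
pose H (i j : 'I_n) := (if (i < j)%N then F j i else 0)%R.
transitivity (\sum_i \sum_j G i j + \sum_i \sum_j H i j)%R.
  rewrite [X in (_ + X)%R]exchange_big -big_split; apply: eq_bigr => i _.
  rewrite -big_split; apply: eq_bigr => j _; rewrite /G /H /F /=.
  case: ltngtP => [||/val_inj->]; rewrite ?addr0 ?add0r //.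
  by rewrite ccommxx mul0rz.
rewrite -big_split; apply: eq_bigr => i _.
rewrite -big_split; apply: eq_bigr => j _; rewrite /G /H /F mxE /=.
by case: ifP; rewrite ?addr0 // [c (t j) _]ccommC mulrzBr mulNrz.
Qed.

(** The class 2 normal form of a word map: one matrix [S] has to serve all tuples. Only its
    existence is tracked, whereas the exponents [m] stay explicit. *)
Definition represents (f : X -> gT) m :=
  exists S, forall t, f t = mono m t * e (cform S t).

Lemma mono0 t : mono 0 t = 1.
Proof. by rewrite /mono big1 // => i _; rewrite mxE. Qed.

Lemma monoD m m' : represents (fun t => mono m t * mono m' t) (m + m')%R.
Proof.
rewrite /represents /mono; elim: (index_enum _) => [|i r [S IH]].
  by exists 0%R => t; rewrite !big_nil cform0 embed0.
have [S' E] : exists S', forall t,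
    c (\prod_(j <- r) zpow (t j) (m 0%R j)) (zpow (t i) (m' 0%R i))
      = cform S' t.
  (* Moving x_i^(m'_i) to the left past the tail of the first monomial costs [x_j, x_i]^(m_j m'_i)
     for each [j] in that tail. *)
  exists (\sum_(j <- r) (m 0 j * m' 0 i) *: delta_mx j i)%R => t.
  rewrite ccomm_prodl (big_morph (cform^~ t) (fun S S' => cformD S S' t) (cform0 t)).
  apply: eq_bigr => j _; rewrite ccomm_zpowr -mulrzA mulrC.
  rewrite /cform (bigD1 j) //= (bigD1 i) //= !mxE !eqxx mulr1.
  rewrite big1 => [|l /negPf l_i]; last by rewrite !mxE l_i andbF mulr0.
  rewrite big1 => [|k /negPf k_j]; first by rewrite !addr0.
  by apply: big1 => l _; rewrite !mxE k_j mulr0.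
exists (S + S')%R => t; rewrite !big_cons mxE zpowD cformD eD -E.
rewrite [RHS]mulgA -[_ * e (cform S t)]mulgA -IH -!mulgA; congr (_ * _).
rewrite [LHS]mulgA [X in X * _ = _]comm_swap -!mulgA.
by congr (_ * (_ * _)); apply: eZ.
Qed.

Lemma represents_mul f g m m' :
  represents f m -> represents g m' ->
  represents (fun t => f t * g t) (m + m')%R.
Proof.
move=> [S fE] [S' gE]; have [S'' E] := monoD m m'.
exists (S + S' + S'')%R => t; rewrite fE gE !cformD !eD.
rewrite -mulgA [e _ * (_ * _)]eZ -!mulgA mulgA E -!mulgA; congr (_ * _).
by rewrite [RHS]mulgA [LHS]eZ -eD [in LHS]addrC eD.
Qed.

Lemma represents1 : represents (fun=> 1) 0%R.
Proof. by exists 0%R => t; rewrite mono0 cform0 embed0 mulg1. Qed.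

Lemma represents_inv f m :
  represents f m -> represents (fun t => (f t)^-1) (- m)%R.
Proof.
move=> [S fE]; have [S' E] := monoD m (- m)%R.
exists (- (S + S'))%R => t; rewrite fE cformN embedN cformD eD.
apply: (mulgI (mono m t * e (cform S t))); rewrite mulgV -mulgA [e _ * (_ * _)]eZ.
by rewrite !mulgA E subrr mono0 mul1g invMg mulgA mulgV mul1g mulVg.
Qed.

Lemma represents_zpow f m z :
  represents f m -> represents (fun t => zpow (f t) z) (z *: m)%R.
Proof.
move=> fm; elim: z => [|k IH|k IH].
- by rewrite scale0r; apply: represents1.
- rewrite -addn1 PoszD scalerDl scale1r.
  have [S E] := represents_mul IH fm.
  by exists S => t; rewrite zpowD1 E.
rewrite -addn1 PoszD opprD scalerDl scaleN1r.
have [S E] := represents_mul IH (represents_inv fm).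
by exists S => t; rewrite zpowB1 E.
Qed.

Lemma mono_delta i t : mono (delta_mx 0%R i) t = t i.
Proof.
rewrite /mono (eq_bigr (fun j => if j == i then t i else 1)).
  by rewrite -big_mkcond big_pred1_eq.
by move=> j _; rewrite mxE eqxx /=; case: eqP => [->|_]; rewrite ?zpow1.
Qed.

Lemma represents_var i : represents (fun t => t i) (delta_mx 0 i)%R.
Proof. by exists 0%R => t; rewrite mono_delta cform0 embed0 mulg1. Qed.

Lemma represents_mono m : represents (mono m) m.
Proof. by exists 0%R => t; rewrite cform0 embed0 mulg1. Qed.

Lemma represents_word (w : fword n) : exists m, represents (eval_word w) m.
Proof.
elim: w => [|[i b] w [m wm]]; first by exists 0%R; apply: represents1.
case: b; last by eexists; apply: represents_mul (represents_var i) wm.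
by eexists; apply: represents_mul (represents_inv (represents_var i)) wm.
Qed.

Lemma represents_subst f m U :
  represents f m -> represents (fun t => f (subst_mx U t)) (m *m U)%R.
Proof.
move=> [S fE]; have [S' E] :
    represents (fun t => mono m (subst_mx U t)) (m *m U)%R.
  rewrite mulmx_sum_row /mono; elim: (index_enum _) => [|i r IH].
    by have [S' E] := represents1; exists S' => t; rewrite !big_nil -E.
  have [S' E] := represents_mul
    (represents_zpow (m 0%R i) (represents_mono (row i U))) IH.
  by exists S' => t; rewrite !big_cons -E ffunE.
exists (S' + U^T *m S *m U)%R => t.
by rewrite fE E cform_subst cformD eD mulgA.
Qed.

(** Substituting back with [invmx U] recovers each coordinate only up to a central factor given by a
    form. Tuples with equal images thus differ by central factors; forms ignore these, so the two
    corrections agree and cancel. *)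
Lemma subst_mx_inj U : U \in unitmx -> injective (subst_mx U).
Proof.
move=> Uu t t' tt'.
have E i : exists S, forall t,
    subst_mx (invmx U) (subst_mx U t) i = t i * e (cform S t).
  have [S E] := represents_subst U (represents_mono (row i (invmx U))).
  exists S => u; rewrite ffunE E -row_mul mulVmx //.
  by rewrite row1 mono_delta.
have ex_a i : exists a, t i == t' i * e a.
  have [S ES] := E i; exists (cform S t' - cform S t)%R; apply/eqP.
  by rewrite eD mulgA -ES -tt' ES -mulgA -eD subrr embed0 mulg1.
pose a i := xchoose (ex_a i).
have ta : t = [ffun i => t' i * e (a i)].
  by apply/ffunP=> i; rewrite ffunE; apply/eqP/(xchooseP (ex_a i)).
apply/ffunP=> i; have [S ES] := E i.
apply: (mulIg (e (cform S t))); rewrite -ES tt' ES.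
by rewrite [in RHS]ta cform_central.
Qed.

End Tuples.

(** * Counting solutions by separating even and odd variables *)

Section Counting.
Variable n : nat.
Local Notation X := {ffun 'I_n.+1 -> gT}.
Implicit Types (t x y : X) (S : 'M[int]_n.+1).

Definition parity_mix (b : bool) x y : X :=
  [ffun i : 'I_n.+1 => if odd i == b then y i else x i].

(** The coordinatewise Mal'cev operation, serving as the translation [tau] of [card_fiber_ge]. *)
Definition mal t x y : X := [ffun i => t i * (x i)^-1 * y i].

Lemma parity_mix_sym b x y : parity_mix b x y = parity_mix (~~ b) y x.
Proof. by apply/ffunP=> i; rewrite !ffunE; case: (odd i); case: b. Qed.

Lemma parity_mixxx b x : parity_mix b x x = x.
Proof. by apply/ffunP=> i; rewrite ffunE if_same. Qed.

Lemma mal_inj t x : injective (mal t x).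
Proof.
by move=> y y' /ffunP E; apply/ffunP=> i; have := E i; rewrite !ffunE => /mulgI.
Qed.

(* When [S] only pairs even with odd indices, [cform S] is affine in the
   coordinates of a fixed parity. *)
Lemma cform_mal S b t x y z : (forall i j : 'I_n.+1, odd i = odd j -> S i j = 0%R) ->
  (cform S (parity_mix b z (mal t x y)) = cform S (parity_mix b z t)
    - cform S (parity_mix b z x) + cform S (parity_mix b z y))%R.
Proof.
move=> S0; rewrite -sumrB -big_split; apply: eq_bigr => i _.
rewrite -sumrB -big_split; apply: eq_bigr => j _ /=.
have [/eqP/S0->|oij] := boolP (odd i == odd j).
  by rewrite !mulr0z subr0 addr0.
rewrite !ffunE -mulrzBl -mulrzDl.
case: (odd i) (odd j) b oij => [] [] [] //= _.
all: by rewrite ?ccommMl ?ccommMr ?ccommVl ?ccommVr.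
Qed.

Lemma card_bipartite_fiber S d (f : X -> gT) (a : X) :
    (forall i j : 'I_n.+1, odd i = odd j -> S i j = 0%R) ->
    (forall t, f t = zpow (t ord0) d * e (cform S t)) ->
  (#|gT| ^ n <= #|A| * #|[set t | f t == f a]|)%N.
Proof.
move=> S0 fE.
(* Full tuples stand in for half tuples: [mix x y] reads the even coordinates of [x] and the odd
   ones of [y]. The ignored coordinates contribute a factor [#|X|], cancelled at the end. *)
pose mix := parity_mix true; pose sol := [set x | f (mix x a) == f a].
have cardX : #|X| = (#|gT| ^ n.+1)%N by rewrite card_ffun card_ord.
have X_gt0 : (0 < #|X|)%N by apply/card_gt0P; exists a.
have mix0 x y : mix x y ord0 = x ord0 by rewrite ffunE.
have card_sol : (#|gT| ^ n <= #|sol|)%N.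
  (* Coordinate 0 is confined to the coset of [a ord0] modulo the central subgroup, where its [d]-th
     power depends additively on [z]; hence [phi] is affine on [A * X]. *)
  pose upd z x : X := [ffun i => if i == ord0 then a ord0 * e z else x i].
  pose phi (p : A * X) := (p.1 *~ d + cform S (mix (upd p.1 p.2) a))%R.
  have fphi z x : f (mix (upd z x) a) = zpow (a ord0) d * e (phi (z, x)).
    by rewrite fE mix0 ffunE eqxx zpowM_embed eD mulgA.
  have upd_a : upd 0%R a = a.
    by apply/ffunP=> i; rewrite ffunE; case: eqP => // ->; rewrite embed0 mulg1.
  pose tau (p q : A * X) := ((q.1 - p.1)%R, mal a p.2 q.2).
  have tau_inj p : injective (tau p).
    move=> [z x] [z' x'] E; have /= /addIr-> := congr1 fst E.
    by have /= /mal_inj-> := congr1 snd E.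
  have := @card_fiber_ge _ _ phi (0%R, a) tau tau_inj.
  rewrite card_prod leq_pmul2l; last by apply/card_gt0P; exists 0%R.
  move=> fib; rewrite -(leq_pmul2l (cardG_gt0 [set: gT])) cardsT.
  rewrite -expnS -cardX; apply: leq_trans (fib _) _.
    move=> [z x] [z' x']; rewrite /phi /= upd_a mul0rz add0r => E.
    (* At index 0 this is a_0 (a_0 e(z))^-1 a_0 e(z') = a_0 e(z' - z). *)
    have -> : upd (z' - z)%R (mal a x x') = mal a (upd z x) (upd z' x').
      apply/ffunP=> i; rewrite !ffunE; case: eqP => // ->.
      by rewrite invMg -!mulgA mulKg -embedN -eD addrC.
    rewrite /mix !(parity_mix_sym true) (cform_mal _ _ _ _ _ S0).
    rewrite -!(parity_mix_sym true) -/mix mulrzBl.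
    move: (cform S (mix a a)) (cform S (mix (upd z x) a)) E => C0 C1.
    move: (cform S _) => C2 E.
    transitivity (C0 + ((z' *~ d + C2) - (z *~ d + C1)))%R.
      rewrite -[(C0 - _ + _)%R]addrA [(- C1 + _)%R]addrC opprD.
      by rewrite [((z' *~ d + C2) + _)%R]addrACA [LHS]addrCA.
    by rewrite -E subrr addr0.
  rewrite -cardsT -cardsX.
  (* [upd] overwrites coordinate 0 of [x], so recording it makes the map injective. The fibre has at
     least |G|^(n+1) points, and landing in [gT * sol] costs one factor |G|. *)
  pose h (p : A * X) := (p.2 ord0, upd p.1 p.2).
  have h_inj : injective h.
    move=> [z x] [z' x'] E.
    have /= E0 := congr1 fst E; have /= /ffunP Eu := congr1 snd E.
    have := Eu ord0; rewrite !ffunE eqxx => /mulgI/e_inj->; congr (_, _).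
    apply/ffunP=> i; have := Eu i; rewrite !ffunE.
    by case: eqP => [->|].
  rewrite -(card_imset _ h_inj); apply/subset_leq_card/subsetP.
  move=> _ /imsetP[[z x] + ->]; rewrite inE => /eqP E.
  by rewrite !inE fphi E -fphi upd_a /mix parity_mixxx eqxx.
have card_y x : x \in sol ->
    (#|X| <= #|A| * #|[set y | f (mix x y) == f a]|)%N.
  rewrite inE => /eqP fx; pose phi y := cform S (mix x y).
  have fphi y : f (mix x y) = zpow (x ord0) d * e (phi y).
    by rewrite fE mix0.
  apply: leq_trans (@card_fiber_ge _ _ phi a (mal a) _ _) _.
  - exact: mal_inj.
  - by move=> y y'; rewrite /phi /mix (cform_mal _ _ _ _ _ S0) => ->; rewrite subrK.
  rewrite leq_mul2l; apply/orP; right; apply/subset_leq_card/subsetP=> y.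
  by rewrite !inE -fx !fphi => /eqP->.
pose P := [set p : X * X | (p.1 \in sol) && (f (mix p.1 p.2) == f a)].
have card_P : (#|P| <= #|[set t | f t == f a]| * #|X|)%N.
  (* Exchanging the odd coordinates of [x] and [y] turns a pair in [P] into a solution together with
     an arbitrary tuple. *)
  pose h (p : X * X) := (mix p.1 p.2, mix p.2 p.1).
  have hK : involutive h.
    by move=> [x y]; congr (_, _); apply/ffunP=> i; rewrite !ffunE; case: odd.
  rewrite -(card_imset _ (inv_inj hK)) -[#|X|]cardsT -cardsX.
  apply/subset_leq_card/subsetP=> _ /imsetP[[x y] + ->].
  by rewrite inE => /andP[_ /= fxy]; rewrite !inE fxy.
rewrite -(leq_pmul2r X_gt0) -mulnA.
apply: leq_trans (leq_mul (leqnn _) card_P).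
apply: leq_trans (leq_mul card_sol (leqnn _)) _.
rewrite -[X in X <= _]sum_nat_const.
apply: (@leq_trans (\sum_(x in sol) #|A| * #|[set y | f (mix x y) == f a]|)%N).
  exact: leq_sum.
rewrite -big_distrr leq_mul2l -sum1_card; apply/orP; right.
rewrite (eq_bigr (fun x => \sum_(y | f (mix x y) == f a) 1)%N) => [|x _].
  rewrite pair_big_dep; by apply/eq_leq/eq_bigl=> p; rewrite !inE.
by rewrite -sum1_card; apply: eq_bigl => y; rewrite inE.
Qed.

(** A first substitution [R] gathers all exponents in x_0^d. A second one, [V], makes the commutator
    matrix bipartite while leaving x_0 untouched, so the power survives. *)
Lemma card_word_fiber (w : fword n.+1) (t0 : X) :
  (#|gT| ^ n <= #|A| * #|[set t | eval_word w t == eval_word w t0]|)%N.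
Proof.
have [m wm] := represents_word w.
have [R Ru mR] := row_reduction_int m.
have [S fS] := represents_subst R wm.
(* Only the skew part of [S] affects the form, and congruence is applied to that part. *)
have AN : ((S - S^T)^T = - (S - S^T))%R by rewrite linearB /= trmxK opprB.
have [U Uu UP] :=
  @bipartite_congruence_step n (S - S^T)%R (@bipartite_congruence n) AN.
pose V : 'M[int]_n.+1 := block_mx (1%:M : 'M_1) 0%R 0%R U.
have Vu : V \in unitmx.
  by rewrite unitmxE (det_ublock (1%:M : 'M_1)) det1 mul1r.
have V0 : row ord0 V = delta_mx 0%R ord0.
  have -> : ord0 = lshift n (ord0 : 'I_1) by apply: val_inj.
  apply/rowP=> j; rewrite mxE [RHS]mxE eqxx /=.
  case: (@split_ordP 1 n j) => i ->.
    by rewrite [LHS](@block_mxEul _ 1 n 1 n) mxE !ord1 !eqxx.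
  by rewrite [LHS](@block_mxEur _ 1 n 1 n) mxE.
pose h t := subst_mx R (subst_mx V t).
have h_inj : injective h := inj_comp (subst_mx_inj Ru) (subst_mx_inj Vu).
(* An injective self-map of a finite set is bijective, so [t0] has a preimage under the change of
   variables. *)
have [h' _ h'K] := injF_bij h_inj.
pose W := (V^T *m S *m V)%R.
pose S' := (\matrix_(i, j) if (i < j)%N then W i j - W j i else 0)%R.
have S'0 (i j : 'I_n.+1) : odd i = odd j -> S' i j = 0%R.
  move=> /UP; rewrite -/V mulmxBr mulmxBl mxE => E; rewrite mxE.
  case: ifP => // _; rewrite -[RHS]E; congr (_ + _)%R; rewrite [RHS]mxE.
  congr (- _)%R; rewrite -[in RHS](trmxK V) -!trmx_mul [RHS]mxE /W.
  by rewrite trmxK mulmxA.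
have fE t : eval_word w (h t)
    = zpow (t ord0) ((m *m R) 0 ord0)%R * e (cform S' t).
  rewrite fS cform_subst cform_upper; congr (_ * _).
  rewrite /mono big_ord_recl big1 => [|i _]; last by rewrite mR.
  by rewrite mulg1 ffunE V0 mono_delta.
apply: leq_trans (card_bipartite_fiber (h' t0) S'0 fE) _.
rewrite leq_mul2l -(card_imset _ h_inj); apply/orP; right.
apply/subset_leq_card/subsetP=> _ /imsetP[t + ->].
by rewrite !inE h'K.
Qed.

End Counting.
End CentralCommutators.

(** * The derived subgroup as an additive group, and the final bound *)

Section AbelianGroupZmodule.
Variables (gT : finGroupType) (D : {group gT}).
Local Open Scope group_scope.

(** The alias carries the proof of commutativity, from which the additive structure on the group is
    built. *)
Definition abelian_zmodule (abD : abelian D) : Type := subg_of D.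

Section Instance.
Variable abD : abelian D.
Local Notation zD := (abelian_zmodule abD).

HB.instance Definition _ := Finite.copy zD (subg_of D).

Lemma abelian_zmodule_addC : commutative (fun x y : (subg_of D) => x * y).
Proof.
move=> x y; apply: val_inj; rewrite /= (centsP abD) //; exact: subgP.
Qed.

HB.instance Definition _ := GRing.isZmodule.Build zD
  (@mulgA (subg_of D)) abelian_zmodule_addC (@mul1g (subg_of D)) (@mulVg (subg_of D)).
End Instance.
End AbelianGroupZmodule.

Lemma card_word_fiber_class2 (gT : finGroupType) n (w : fword n.+1)
    (t0 : {ffun 'I_n.+1 -> gT}) : nil_class [set: gT] <= 2 ->
  #|gT| ^ n <= #|[set: gT]^`(1)%g| *
    #|[set t | eval_word w t == eval_word w t0]|.
Proof.
rewrite nil_class2; set D := [set: gT]^`(1)%G => sDZ.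
have cD x y : x \in D -> commute x y.
  by move=> /(subsetP sDZ)/centerP[_]; apply; rewrite inE.
have abD : abelian D by apply/centsP=> x xD y _; apply: cD.
have commD x y : [~ x, y]%g \in D by rewrite mem_commg ?inE.
pose e (z : abelian_zmodule abD) := sgval z.
have -> : #|D| = #|{: abelian_zmodule abD}| by rewrite card_sub.
apply: (@card_word_fiber gT _ e (fun x y => subg D [~ x, y]%g)).
- by [].
- exact: val_inj.
- by move=> z x; apply/cD/subgP.
- by move=> x y; apply: subgK.
Qed.

Lemma eval_word_sgval (gT : finGroupType) (G : {group gT}) k (w : fword k)
    (t : {ffun 'I_k -> subg_of G}) :
  sgval (eval_word w t) = eval_word w [ffun i => sgval (t i)].
Proof. by elim: w => //= -[i b] w <-; rewrite ffunE; case: b. Qed.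

Theorem theorem3p1 (gT : finGroupType) (G : {group gT}) (k : nat) (w : fword k) (g : gT) :
  nilpotent G -> nil_class G = 2 -> (0 < k)%N ->
  g \in word_image w G ->
  (1 / ((#|(G^`(1))%g| * #|G|)%N)%:R <= word_prob w G g)%R.
Proof.
move=> _ clG; case: k w => // n w _ /imsetP[t0 t0G ->].
set N := [set t in tuples_in n.+1 G | eval_word w t == eval_word w t0].
rewrite inE in t0G; move/forallP in t0G.
have isoG := isog_subg G.
(* The count is made in the group type [subg_of G], whose tuples embed in those of [G] by
   [sgval]. *)
have card_N : (#|G| ^ n <= #|G^`(1)%g| * #|N|)%N.
  pose s0 := [ffun i => subg G (t0 i)].
  have s0E : [ffun i => sgval (s0 i)] = t0.
    by apply/ffunP=> i; rewrite !ffunE subgK.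
  have -> : #|G| = #|subg_of G| by rewrite card_sub.
  rewrite (card_isog (isog_der 1 isoG)).
  apply: leq_trans (card_word_fiber_class2 w s0 _) _.
    by rewrite -(isog_nil_class isoG) clG.
  rewrite leq_mul2l; apply/orP; right.
  pose h (t : {ffun 'I_n.+1 -> subg_of G}) := [ffun i => sgval (t i)].
  have h_inj : injective h.
    by move=> t t' /ffunP E; apply/ffunP=> i; have := E i; rewrite !ffunE => /val_inj.
  rewrite -(card_imset _ h_inj); apply/subset_leq_card/subsetP.
  move=> _ /imsetP[t + ->]; rewrite !inE => /eqP E.
  rewrite -eval_word_sgval E eval_word_sgval s0E eqxx andbT.
  by apply/forallP=> i; rewrite ffunE subgP.
(* Clearing denominators leaves |G|^(n+1) <= |N| |G'| |G|, which is [card_N] multiplied by |G|. *)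
rewrite /word_prob -/N div1r ler_pdivlMr ?ltr0n ?expn_gt0 ?cardG_gt0 //.
rewrite mulrC ler_pdivrMr ?ltr0n ?muln_gt0 ?cardG_gt0 // -natrM ler_nat.
by rewrite expnSr mulnA leq_mul2r [(#|N| * _)%N]mulnC card_N orbT.
Qed.
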